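(* Let $n,m$ be positive integers, $\zeta_n=e^{2\pi\sqrt{-1}/n}$, and for positive integers $s_1,\dots,s_m$ put $$\mathfrak Z_n(\zeta_n;;s_1,\dots,s_m)=\sum_{1\le i_1<\dots<i_m\le n-1}\prod_{k=1}^m\frac{1}{(1-\zeta_n^{i_k})^{s_k}}.$$ For a positive integer $A$ write $\mathfrak Z_n(\zeta_n;;2^{j-1},A,2^{m-j})$ for this sum with $s_j=A$ and $s_i=2$ for $i\ne j$. Then for even $A\ge 2$, \begin{align*} \sum_{j=1}^{m}\mathfrak Z_n(\zeta_n;;2^{j-1},A,2^{m-j}) &=\sum_{k=0}^{\frac{A}{2}-2}\sum_{j=1}^{A-2 k-2}\frac{(-1)^{k+1}n^j\beta_j(n^{-1})}{n(m+k+1)\,j!}\binom{A-2 k-3}{j-1}\left(\binom{n-1}{m+k}+(-1)^{m+k}\binom{n-1}{2 m+2 k+1}\right)\\ &\quad +(-1)^{\frac{A}{2}-1}\frac{m+\frac{A}{2}-1}{n(m+\frac{A}{2})}\left(\binom{n-1}{m+\frac{A}{2}-1}+(-1)^{m+\frac{A}{2}-1}\binom{n-1}{2 m+A-1}\right), \end{align*} and for odd $A\ge 1$, \begin{align*} \sum_{j=1}^{m}\mathfrak Z_n(\zeta_n;;2^{j-1},A,2^{m-j}) &=\sum_{k=0}^{\frac{A-3}{2}}\sum_{j=1}^{A-2 k-2}\frac{(-1)^{k+1}n^j\beta_j(n^{-1})}{n(m+k+1)\,j!}\binom{A-2 k-3}{j-1}\left(\binom{n-1}{m+k}+(-1)^{m+k}\binom{n-1}{2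 m+2 k+1}\right)\\ &\quad +(-1)^{\frac{A-1}{2}}\frac{1}{n}\left(\binom{n-1}{m+\frac{A-1}{2}}+(-1)^{m+\frac{A-3}{2}}\binom{n-1}{2 m+A-1}\right). \end{align*}
   Context: The degenerate Bernoulli numbers $\beta_k(\lambda)$ (Carlitz) are defined by $\dfrac{t}{(1+\lambda t)^{1/\lambda}-1}=\sum_{k=0}^\infty\beta_k(\lambda)\dfrac{t^k}{k!}$. Binomial coefficients $\binom{a}{b}$ vanish for $b>a$ or $b<0$; sums whose upper limit is below the lower limit are empty and equal $0$. *)

(* Defs.v *)
From mathcomp Require Import all_boot all_order all_algebra.
From mathcomp Require Import all_classical all_reals all_analysis.
From mathcomp Require Import complex.

Set Implicit Arguments.
Unset Strict Implicit.
Unset Printing Implicit Defensive.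

Import Order.TTheory GRing.Theory Num.Theory.

Local Open Scope ring_scope.

(* A formal power series is represented by its coefficient sequence nat -> F. *)
Section PowerSeries.
Variable F : fieldType.

Definition series_mul (f g : nat -> F) (k : nat) : F :=
  \sum_(i < k.+1) f i * g (k - i)%N.

(* The first k coefficients of 1 / f, for a series f with f 0 != 0. *)
Fixpoint series_inv_seq (f : nat -> F) (k : nat) : seq F :=
  if k is k'.+1 then
    let s := series_inv_seq f k' in
    rcons s (((k' == 0)%:R - \sum_(i < k') f (k' - i)%N * s`_i) / f 0)
  else [::].

Definition series_inv (f : nat -> F) (k : nat) : F := (series_inv_seq f k.+1)`_k.

(* The binomial series: (1 + l t)^(1/l) = \sum_k binom(1/l, k) l^k t^k, for a
   nonzero l. *)
Definition degen_exp (l : F) (k : nat) : F :=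
  (\prod_(i < k) (l^-1 - i%:R)) / k`!%:R * l ^+ k.

(* Since degen_exp l 0 = 1, the series ((1 + l t)^(1/l) - 1) / t is the shift of
   degen_exp l; its inverse is \sum_k beta_k(l) t^k / k!. *)
Definition degen_bernoulli (l : F) (k : nat) : F :=
  k`!%:R * series_inv (fun j => degen_exp l j.+1) k.

Lemma size_series_inv_seq f k : size (series_inv_seq f k) = k.
Proof. by elim: k => //= k IH; rewrite size_rcons IH. Qed.

Lemma nth_series_inv_seq f k i :
  (i < k)%N -> (series_inv_seq f k)`_i = series_inv f i.
Proof.
elim: k => // k IH; rewrite ltnS leq_eqVlt => /orP[/eqP -> //|ik].
by rewrite /= nth_rcons size_series_inv_seq ik IH.
Qed.

Lemma series_invE f k :
  series_inv f k =
  ((k == 0)%:R - \sum_(i < k) f (k - i)%N * series_inv f i) / f 0.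
Proof.
rewrite {1}/series_inv /= nth_rcons size_series_inv_seq ltnn eqxx.
by congr ((_ - _) / _); apply: eq_bigr => i _; rewrite nth_series_inv_seq.
Qed.

Lemma series_mulV f k : f 0 != 0 -> series_mul f (series_inv f) k = (k == 0)%:R.
Proof.
move=> f0; rewrite /series_mul (reindex_inj rev_ord_inj) big_ord_recr /=.
rewrite subSS subnn subn0 [in f 0 * _]series_invE mulrC divfK //.
rewrite addrC -[RHS]addr0 -addrA; congr (_ + _).
apply/eqP; rewrite addrC subr_eq0; apply/eqP; apply: eq_bigr => i _.
by rewrite subSS subKn // ltnW.
Qed.

End PowerSeries.

(* The defining identity ((1 + l t)^(1/l) - 1) \sum_k b_k t^k / k! = t holds for
   the sequence degen_bernoulli l, and only for it. *)
Lemma degen_bernoulliP (F : numFieldType) (l : F) (b : nat -> F) : l != 0 ->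
  (forall k, series_mul (fun j => degen_exp l j - (j == 0)%:R)
                        (fun j => b j / j`!%:R) k = (k == 1)%:R) <->
  b =1 degen_bernoulli l.
Proof.
move=> l0; pose g j := degen_exp l j.+1.
have g0 : g 0 != 0.
  rewrite /g /degen_exp big_ord1 subr0 factS fact0 muln1 divr1 expr1.
  by rewrite mulVf // oner_eq0.
have fN0 j : (j`!%:R : F) != 0 by rewrite pnatr_eq0 -lt0n fact_gt0.
have shift c k : series_mul (fun j => degen_exp l j - (j == 0)%:R) c k.+1
                 = series_mul g c k.
  rewrite /series_mul big_ord_recl /= {1}/degen_exp big_ord0 fact0 invr1.
  rewrite !mulr1 subrr mul0r add0r; apply: eq_bigr => i _.
  by rewrite /= subr0 subSS.
have shift0 c : series_mul (fun j => degen_exp l j - (j == 0)%:R) c 0 = 0.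
  rewrite /series_mul big_ord1 /= /degen_exp big_ord0 fact0 invr1.
  by rewrite !mulr1 subrr mul0r.
split=> [H k|H [|k]].
- suff E j : b j / j`!%:R = series_inv g j.
    by rewrite /degen_bernoulli -E mulrC divfK.
  elim/ltn_ind: j => j IH; apply: (mulfI g0).
  have := H j.+1; rewrite shift -(series_mulV j g0) /series_mul !big_ord_recl.
  rewrite /= !subn0 => /(congr1 (fun x => x - \sum_(i < j) g (bump 0 i) *
    series_inv g (j - bump 0 i)%N)); rewrite addrK => <-.
  rewrite -[LHS](addrK (\sum_(i < j) g (bump 0 i) *
     series_inv g (j - bump 0 i)%N)); congr (_ + _ - _).
  apply: eq_bigr => i _; rewrite IH //.
  by rewrite /bump /= add1n ltn_subrL /= (leq_ltn_trans _ (ltn_ord i)).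
- by rewrite shift0.
rewrite shift eqSS -(series_mulV k g0); apply: eq_bigr => i _.
by rewrite H /degen_bernoulli [X in _ * (X / _)]mulrC mulfK.
Qed.

(* exp(2 pi sqrt(-1) / n) *)
Definition zeta (R : realType) (n : nat) : R[i] :=
  Complex (cos (2 * pi / n%:R)) (sin (2 * pi / n%:R)).

(* An index tuple 1 <= i_1 < ... < i_m <= n - 1 is a strictly increasing
   function from 'I_m to the nonzero elements of 'I_n; positions are numbered
   from 0. *)
Definition frakZ (F : fieldType) (n m : nat) (q : F) (s : 'I_m -> nat) : F :=
  \sum_(i : {ffun 'I_m -> 'I_n} |
          [forall k, (0 < i k)%N] &&
          [forall k : 'I_m, forall l : 'I_m, (k < l)%N ==> (i k < i l)%N])
    \prod_(k < m) ((1 - q ^+ i k) ^+ s k)^-1.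

(* The exponents (2^{j-1}, A, 2^{m-j}), i.e. A at position j and 2 elsewhere. *)
Definition two_but_at (m : nat) (j : 'I_m) (A : nat) (i : 'I_m) : nat :=
  if i == j then A else 2%N.

(* Main.v *)
(* Put x_i = 1 / (1 - q^i).  Since 'X^n - 1 splits over the powers of q,
   n z \prod_i (1 + x_i z) = (1 + z)^n - 1.  Two consequences follow.
   - Multiplying by the same identity at -z gives the elementary symmetric
     functions e_k of the x_i^2; differentiating gives
     \sum_i x_i e_k(x_l^2, l != i).
   - The reciprocal n z / ((1 + z)^n - 1), which is the generating series of
     the n^j beta_j(1/n) / j!, has the partial fraction expansion
     n^j beta_j(1/n) / j! = - \sum_i q^i (- x_i)^j for j > 0.  With
     - q^i x_i = x_{n-i} = 1 - x_i this yields the power sums p_s of the x_i.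
   The left-hand side is S_(A,m) = \sum_i x_i^A e_(m-1)(x_l^2, l != i), and
   e_m = e_m(x_l^2, l != i) + x_i^2 e_(m-1)(x_l^2, l != i) gives
   S_(A+2,m) = p_A e_m - S_(A,m+1), which is unrolled down to A = 1 or 2. *)

Require Import Defs.
From mathcomp Require Import all_boot all_order all_algebra.
From mathcomp Require Import all_classical all_reals all_analysis.
From mathcomp Require Import complex.
From mathcomp Require Import ring zify.

Import Order.TTheory GRing.Theory Num.Theory.

Local Open Scope ring_scope.

(** * Increasing tuples as subsets, and coefficients of products of linear factors *)

(** An increasing tuple is recovered from its set of values by sorting, and [enum_val] lists every
    set of size [m] increasingly. *)
Lemma sum_incr_imset (V : nmodType) (m n : nat) (G : {set 'I_n} -> V) :
  \sum_(f : {ffun 'I_m -> 'I_n} |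
      [forall k : 'I_m, forall l : 'I_m, (k < l)%N ==> (f k < f l)%N])
    G [set f k | k in 'I_m] = \sum_(S : {set 'I_n} | #|S| == m) G S.
Proof.
pose incr (f : {ffun 'I_m -> 'I_n}) :=
  [forall k : 'I_m, forall l : 'I_m, (k < l)%N ==> (f k < f l)%N].
have incrP (f : {ffun 'I_m -> 'I_n}) :
    reflect (forall k l : 'I_m, (k < l)%N -> (f k < f l)%N) (incr f).
  apply: (iffP forallP) => [H k l kl|H k].
    by have /forallP/(_ l)/implyP/(_ kl) := H k.
  by apply/forallP => l; apply/implyP; apply: H.
have ltn_ord_trans p : transitive (fun i j : 'I_p => (i < j)%N).
  by move=> ? ? ?; apply: ltn_trans.
have sorted_enum p (S : {pred 'I_p}) :
    sorted (fun i j : 'I_p => (i < j)%N) (enum S).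
  apply: sorted_filter => //; rewrite -enumT.
  by have := iota_ltn_sorted 0 p; rewrite -val_enum_ord sorted_map.
have inj : {in incr &, injective
    (fun f : {ffun 'I_m -> 'I_n} => [set f k | k in 'I_m])}.
  move=> f g /incrP incf /incrP incg /setP fg.
  have E : codom f = codom g.
    apply: (irr_sorted_eq (@ltn_ord_trans n)).
    - by move=> i; rewrite /= ltnn.
    - exact: (homo_sorted incf).
    - exact: (homo_sorted incg).
    move=> i; have codomE (h : {ffun 'I_m -> 'I_n}) :
      (i \in codom h) = (i \in [set h k | k in 'I_m]).
      by apply/codomP/imsetP => -[k]; [exists k | exists k].
    by rewrite !codomE fg.
  apply/ffunP => k.
  by have /eq_in_map -> := E; rewrite ?mem_enum.
rewrite -(big_imset G inj); apply: eq_bigl => S.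
apply/imsetP/eqP => [[f /incrP incf ->]|cardS].
  rewrite card_imset ?card_ord // => k l fkl; apply/val_inj/eqP.
  by case: ltngtP => // /incf; rewrite fkl ltnn.
exists [ffun k : 'I_m => enum_val (cast_ord (esym cardS) k)].
  apply/incrP => k l kl; rewrite !ffunE.
  have i0 := enum_val (cast_ord (esym cardS) k).
  rewrite !(enum_val_nth i0).
  apply: (sorted_ltn_nth (@ltn_ord_trans n)) => //;
    by rewrite inE -cardE ltn_ord.
apply/setP => i; apply/idP/imsetP => [iS|[k _ ->]]; last first.
  by rewrite ffunE enum_valP.
exists (cast_ord cardS (enum_rank_in iS i)) => //.
by rewrite ffunE cast_ordK enum_rankK_in.
Qed.

(** Expanding the product, [S] is the set of factors that contribute their ['X] term. *)
Lemma coef_prod_linear (F : comNzRingType) (I : finType) (a b : I -> F) m :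
  (\prod_i (b i *: 'X + (a i)%:P))`_m =
  \sum_(S : {set I} | #|S| == m) \prod_i (if i \in S then b i else a i).
Proof.
rewrite bigA_distr /= coef_sum [RHS]big_mkcond; apply: eq_bigr => S _.
transitivity ((\prod_i (if i \in S then b i else a i)) *:
  'X^(#|S|) : {poly F})`_m; last first.
  by rewrite coefZ coefXn eq_sym; case: eqP => _; rewrite ?mulr1 ?mulr0.
apply: (congr1 (fun p : {poly F} => p`_m)); rewrite -sum1_card -prodrXr.
rewrite [X in _ *: X]big_mkcond -mul_polyC rmorph_prod -big_split /=.
by apply: eq_bigr => i _; case: ifP; rewrite ?mulr1 ?mul_polyC.
Qed.

(** * Generating polynomials of elementary symmetric functions *)

(** The coefficients are the elementary symmetric functions of the [x i]. *)
Definition linprod {F : comNzRingType} {I : finType} (x : I -> F) : {poly F} :=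
  \prod_i (x i *: 'X + 1).

(* The coefficient of degree m - 1 is the S_(A,m) of the header. *)
Definition marked_linprod {F : comNzRingType} {I : finType} (x : I -> F)
    (A : nat) : {poly F} :=
  \sum_i x i ^+ A *: \prod_(l | l != i) (x l ^+ 2 *: 'X + 1).

Lemma linprodD1 {F : comNzRingType} {I : finType} (x : I -> F) i :
  linprod x = (x i *: 'X + 1) * \prod_(l | l != i) (x l *: 'X + 1).
Proof. by rewrite /linprod (bigD1 i). Qed.

(** Termwise: if [P] is the product over [l != i], then [x i ^+ 2 *: 'X * P] is the full product
    minus [P]. *)
Lemma marked_linprodSS {F : comNzRingType} {I : finType} (x : I -> F) A :
  'X * marked_linprod x A.+2 =
  (\sum_i x i ^+ A) *: linprod (fun i => x i ^+ 2) - marked_linprod x A.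
Proof.
rewrite /marked_linprod mulr_sumr scaler_suml -sumrB; apply: eq_bigr => i _.
rewrite (linprodD1 _ i) -addn2 exprD -!mul_polyC !rmorphM /=; ring.
Qed.

Lemma deriv_linprod {F : comNzRingType} {I : finType} (x : I -> F) :
  (linprod x)^`() = \sum_i x i *: \prod_(l | l != i) (x l *: 'X + 1).
Proof.
(* Induction runs over duplicate-free lists, where [l != i] removes exactly one factor. *)
have deriv_prod (s : seq I) : uniq s ->
    (\prod_(i <- s) (x i *: 'X + 1))^`() =
    \sum_(i <- s) x i *: \prod_(l <- s | l != i) (x l *: 'X + 1).
  elim: s => [|i s IH] /=; first by rewrite !big_nil derivC.
  case/andP=> is_ us; rewrite !big_cons derivM IH // eqxx.
  rewrite derivD derivZ derivX derivC addr0 -scalerAl mul1r mulr_sumr.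
  congr (_ *: _ + _).
    rewrite big_seq [RHS]big_seq_cond; apply: eq_bigl => l.
    by case: eqP => [->|_]; rewrite ?(negPf is_) ?andbT.
  apply: eq_big_seq => j js; rewrite big_cons ifT ?scalerAr //.
  by apply: contraNneq is_ => ->.
exact: deriv_prod (index_enum_uniq I).
Qed.

Lemma deriv_linprod_sqr {F : comNzRingType} {I : finType} (x : I -> F) :
  (linprod (fun i => x i ^+ 2))^`() = marked_linprod x 2.
Proof. exact: deriv_linprod. Qed.

(** Factorwise, [1 - x ^+ 2 * z ^+ 2 = (1 + x * z) * (1 - x * z)]. *)
Lemma linprod_sqr_comp {F : comNzRingType} {I : finType} (x : I -> F) :
  linprod (fun i => x i ^+ 2) \Po - 'X^2 = linprod x * (linprod x \Po - 'X).
Proof.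
rewrite /linprod !rmorph_prod -big_split; apply: eq_bigr => i _ /=.
rewrite !comp_polyD !comp_polyZ !comp_polyX !comp_polyC.
rewrite -!mul_polyC !rmorphM /=; ring.
Qed.

(** For each [i] the factors of index [l != i] pair up as differences of squares, and what remains
    is [x i * ((1 - x i * z) + (1 + x i * z)) = 2 * x i]. *)
Lemma marked_linprod1_comp {F : comNzRingType} {I : finType} (x : I -> F) :
  (linprod x)^`() * (linprod x \Po - 'X)
  + linprod x * ((linprod x)^`() \Po - 'X) =
  (marked_linprod x 1 \Po - 'X^2) *+ 2.
Proof.
rewrite deriv_linprod /marked_linprod !raddf_sum /= mulr_suml mulr_sumr.
rewrite -big_split -sumrMnl /=; apply: eq_bigr => i _.
rewrite (linprodD1 _ i) !comp_polyZ !comp_polyM.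
have -> : \prod_(l | l != i) (x l ^+ 2 *: 'X + 1) \Po - 'X^2 =
  \prod_(l | l != i) (x l *: 'X + 1) *
  (\prod_(l | l != i) (x l *: 'X + 1) \Po - 'X).
  rewrite !rmorph_prod -big_split; apply: eq_bigr => l _ /=.
  rewrite !comp_polyD !comp_polyZ !comp_polyX !comp_polyC.
  rewrite -!mul_polyC !rmorphM /=; ring.
rewrite !comp_polyD !comp_polyZ !comp_polyX !comp_polyC.
rewrite -!mul_polyC expr1; ring.
Qed.

Lemma coef_comp_polyNX {F : comNzRingType} (p : {poly F}) k :
  (p \Po - 'X)`_k = (-1) ^+ k * p`_k.
Proof.
elim/poly_ind: p k => [|p c IH] k; first by rewrite comp_poly0 coef0 mulr0.
rewrite comp_poly_MXaddC !coefD !coefC mulrN coefN !coefMX.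
case: k => [|k] /=; first by rewrite oppr0 mul1r.
by rewrite !addr0 IH exprS mulN1r mulNr.
Qed.

Lemma coef_comp_polyNX2 {F : comNzRingType} (p : {poly F}) k :
  (p \Po - 'X^2)`_(2 * k) = (-1) ^+ k * p`_k.
Proof.
have -> : - 'X^2 = (- 'X) \Po 'X^2 :> {poly F} by rewrite rmorphN /= comp_polyX.
rewrite comp_polyA coef_comp_poly_Xn // dvdn_mulr // mulKn //.
exact: coef_comp_polyNX.
Qed.

Lemma coef_XD1n {F : comNzRingType} n k :
  (('X + 1) ^+ n : {poly F})`_k = 'C(n, k)%:R.
Proof.
rewrite addrC exprDn coef_sum.
under eq_bigr do rewrite expr1n mul1r coefMn coefXn.
case: (ltnP k n.+1) => kn; last first.
  rewrite bin_small // big1 // => i _.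
  by rewrite gtn_eqF ?mul0rn // (leq_trans (ltn_ord i)).
rewrite (bigD1 (Ordinal kn)) //= eqxx big1 ?addr0 // => i ik.
by rewrite eq_sym -[k]/(val (Ordinal kn)) val_eqE (negPf ik) mul0rn.
Qed.

(* The index 0, excluded from [frakZ], is harmless in all sums and products
   over ['I_n]: there [(1 - q ^+ 0)^-1 = 0^-1 = 0],
   and all exponents are positive. *)
Definition invx {F : fieldType} {n : nat} (q : F) (i : 'I_n) : F :=
  (1 - q ^+ i)^-1.

(** * The sum of the [frakZ] as a coefficient of [marked_linprod] *)

Lemma frakZE (F : fieldType) (n m : nat) (q : F) (s : 'I_m -> nat) :
  (forall k, 0 < s k)%N ->
  frakZ n q s =
  \sum_(f : {ffun 'I_m -> 'I_n} |
      [forall k : 'I_m, forall l : 'I_m, (k < l)%N ==> (f k < f l)%N])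
    \prod_(k < m) invx q (f k) ^+ s k.
Proof.
move=> s_gt0; rewrite /frakZ [LHS]big_mkcond [RHS]big_mkcond.
apply: eq_bigr => f _; case: forallP => [_|f0] /=.
  by case: ifP => // _; apply: eq_bigr => k _; rewrite /invx exprVn.
case: ifP => // _; apply/esym/eqP/prodf_eq0.
have /forallPn[k] : ~~ [forall k, 0 < f k]%N by apply/forallP.
rewrite -leqNgt leqn0 => /eqP fk0; exists k => //.
by rewrite /invx fk0 expr0 subrr invr0 expr0n (negPf (lt0n_neq0 (s_gt0 k))).
Qed.

Lemma sum_prod_imset (F : comNzRingType) (I J : finType) (f : I -> J)
    (x : J -> F) (A B : nat) : injective f ->
  \sum_j \prod_k x (f k) ^+ (if k == j then A else B) =
  \sum_(i in f @: I) \prod_(l in f @: I) x l ^+ (if l == i then A else B).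
Proof.
move=> f_inj; rewrite big_imset /=; last by move=> ? ? _ _; apply: f_inj.
apply: eq_bigr => j _; rewrite big_imset /=; last first.
  by move=> ? ? _ _; apply: f_inj.
by apply: eq_bigr => k _; rewrite (inj_eq f_inj).
Qed.

Lemma coef_marked_linprod (F : comNzRingType) (I : finType) (x : I -> F) A m :
  (marked_linprod x A)`_m =
  \sum_(S : {set I} | #|S| == m.+1)
    \sum_(i in S) \prod_(l in S) x l ^+ (if l == i then A else 2%N).
Proof.
transitivity ('X * marked_linprod x A)`_m.+1; first by rewrite coefXM.
pose b i l := x l ^+ (if l == i then A else 2%N).
(* The constant term is 0 at [l = i], so only sets [S] containing [i] survive the expansion. *)
have -> : 'X * marked_linprod x A =
    \sum_i \prod_l (b i l *: 'X + ((l != i)%:R)%:P).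
  rewrite mulr_sumr; apply: eq_bigr => i _.
  rewrite [RHS](bigD1 i) //= /b !eqxx addr0 -scalerAr -scalerAl.
  congr (_ *: (_ * _)); apply: eq_bigr => l /negPf il.
  by rewrite il.
rewrite coef_sum; under eq_bigr do rewrite coef_prod_linear.
rewrite exchange_big; apply: eq_bigr => S _.
rewrite [RHS]big_mkcond; apply: eq_bigr => i _.
case: ifP => iS; last first.
  by rewrite (bigD1 i) //= iS eqxx mul0r.
rewrite [RHS]big_mkcond; apply: eq_bigr => l _.
by case: ifP => // lS; case: eqP lS => // ->; rewrite iS.
Qed.

(** Marking a position [j] of a tuple [f] amounts to marking the element [f j] of its image. *)
Lemma sum_frakZ (F : fieldType) (n m : nat) (q : F) (A : nat) : (0 < A)%N ->
  \sum_(j < m.+1) frakZ n q (two_but_at j A) =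
  (marked_linprod (@invx F n q) A)`_m.
Proof.
move=> A_gt0; rewrite coef_marked_linprod -sum_incr_imset.
under eq_bigr => j _.
  rewrite frakZE; last by move=> k; rewrite /two_but_at; case: ifP.
  over.
rewrite exchange_big; apply: eq_bigr => f /forallP incf.
rewrite -sum_prod_imset // => k l fkl; apply/val_inj/eqP.
have lt (i j : 'I_m.+1) : (i < j)%N -> (f i < f j)%N.
  by have /forallP/(_ j)/implyP := incf i.
by case: ltngtP => // /lt; rewrite fkl ltnn.
Qed.

(** * Symmetric functions of the [x i] for a primitive root of unity *)

Section PrimitiveRoot.
Variables (F : numFieldType) (n' : nat) (q : F).
Local Notation n := n'.+1.
Hypothesis qP : n.-primitive_root q.
Local Notation x := (@invx F n q).

Lemma sub1_prim_expr_neq0 i : (0 < i < n)%N -> 1 - q ^+ i != 0.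
Proof.
by case/andP=> i0 iltn; rewrite subr_eq0 eq_sym -(prim_order_dvd qP) gtnNdvd.
Qed.

(** Substituting ['X + 1] into the factorization of ['X^n - 1] turns the factor of index 0 into ['X]
    and every other one into [(1 - q ^+ i) *: (x i *: 'X + 1)]. *)
Lemma linprod_invx : 'X * (n%:R *: linprod x) = ('X + 1) ^+ n - 1.
Proof.
have := congr1 (fun p : {poly F} => p \Po ('X + 1)) (factor_Xn_sub_1 qP).
rewrite comp_polyB rmorphXn /= comp_polyX comp_polyC big_mkord rmorph_prod /=.
rewrite big_ord_recl expr0 comp_polyB comp_polyX comp_polyC addrK.
pose c := \prod_(i < n') (1 - q ^+ i.+1).
have prodE : \prod_(i < n') (('X - (q ^+ (lift ord0 i))%:P) \Po ('X + 1)) =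
    c *: linprod x :> {poly F}.
  rewrite /linprod big_ord_recl {1}/invx expr0 subrr invr0 scale0r add0r mul1r.
  rewrite -mul_polyC /c rmorph_prod -big_split; apply: eq_bigr => i _ /=.
  rewrite comp_polyB comp_polyX comp_polyC mul_polyC /invx.
  rewrite scalerDr scalerA mulfV ?scale1r; last first.
    by rewrite sub1_prim_expr_neq0 //= ltnS ltn_ord.
  by rewrite alg_polyC rmorphB /= addrA.
(* The constant [c] is found by comparing the coefficients of degree 1. *)
rewrite prodE => cE; suff -> : n%:R = c by [].
have linprod0 : (linprod x)`_0 = 1.
  rewrite -horner_coef0 horner_prod big1 // => i _.
  by rewrite !hornerE.
have := congr1 (fun p : {poly F} => p`_1) cE.
rewrite coefXM coefZ linprod0 coefD coefN coefC coef_XD1n bin1 /=.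
by rewrite subr0 mulr1 => ->.
Qed.

Lemma coef_linprod_sqr_invx k :
  (linprod (fun i => x i ^+ 2))`_k =
  (n%:R * k.+1%:R)^-1 * ('C(n', k)%:R + (-1) ^+ k * 'C(n', (2 * k).+1)%:R).
Proof.
set E := linprod _; pose G : {poly F} := ('X + 1) ^+ n.
(* This is [(G - 1) * ((G \Po - 'X) - 1)], expanded with [G * (G \Po - 'X) = G \Po - 'X^2]. *)
have GE : ('X * (n%:R ^+ 2 *: E)) \Po - 'X^2 =
    (G \Po - 'X^2) - G - (G \Po - 'X) + 1.
  rewrite comp_polyM comp_polyX comp_polyZ linprod_sqr_comp.
  have /(congr1 (fun p : {poly F} => p \Po - 'X)) := linprod_invx.
  rewrite comp_polyB comp_polyM comp_polyX comp_polyZ comp_polyC -/G.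
  have -> : G \Po - 'X^2 = G * (G \Po - 'X).
    rewrite /G !rmorphXn /= -exprMn !comp_polyD !comp_polyX !comp_polyC.
    by congr (_ ^+ _); ring.
  have := linprod_invx; rewrite -/G => e1 e2.
  transitivity ((G - 1) * ((G \Po - 'X) - 1)); last by ring.
  by rewrite -e1 -e2 -!mul_polyC rmorphXn /=; ring.
have := congr1 (fun p : {poly F} => p`_(2 * k.+1)) GE.
rewrite coef_comp_polyNX2 coefXM /= coefZ coefD coefC mulnS /= addr0.
rewrite !coefD !coefN -mulnS coef_comp_polyNX2 coef_comp_polyNX !coef_XD1n.
rewrite exprM sqrrN expr1n expr1n mul1r.
(* Absorption identities pass from row [n] of the binomial coefficients to row [n']. *)
have bin_k : n%:R * 'C(n', k)%:R = k.+1%:R * 'C(n, k.+1)%:R :> F.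
  by rewrite -!natrM mul_bin_diag.
have bin_2k :
    n%:R * 'C(n', (2 * k).+1)%:R = 2 * k.+1%:R * 'C(n, 2 * k.+1)%:R :> F.
  by rewrite -!natrM mulnS mul_bin_diag.
have n0 : n%:R != 0 :> F by rewrite pnatr_eq0.
have k0 : k.+1%:R != 0 :> F by rewrite pnatr_eq0.
rewrite exprS mulN1r; set s := (-1) ^+ k => e.
have s2 : s * s = 1 by rewrite -expr2 sqrr_sign.
have s0 : s != 0 by rewrite signr_eq0.
apply: (mulfI k0); apply: (mulfI (mulf_neq0 n0 n0)); apply: (mulfI s0).
transitivity (- k.+1%:R * (- s * (n%:R ^+ 2 * E`_k))); first by ring.
rewrite e; transitivity (s * (k.+1%:R * 'C(n, k.+1)%:R) +
  2 * k.+1%:R * 'C(n, 2 * k.+1)%:R); first by ring.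
(* A factor [s * s = 1] is inserted by hand, so that [field] can treat [s] as a variable. *)
rewrite -bin_k -bin_2k -[_ * 'C(n', (2 * k).+1)%:R]mul1r -s2.
by field; rewrite s0 -!mulrS n0 k0.
Qed.

Lemma coef_marked_linprod1_invx k :
  (marked_linprod x 1)`_k =
  n%:R^-1 * ('C(n', k.+1)%:R + (-1) ^+ k * 'C(n', 2 * k.+1)%:R).
Proof.
set T := marked_linprod x 1; pose H : {poly F} := ('X + 1) ^+ n'.
have n0 : n%:R != 0 :> F by rewrite pnatr_eq0.
have HE : (('X * (n%:R *: T)) \Po - 'X^2) *+ 2 =
    (H \Po - 'X^2) *+ 2 - H - (H \Po - 'X).
  rewrite comp_polyM comp_polyX comp_polyZ.
  have -> : H \Po - 'X^2 = H * (H \Po - 'X).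
    rewrite /H !rmorphXn /= -exprMn !comp_polyD !comp_polyX !comp_polyC.
    by congr (_ ^+ _); ring.
  pose Q := linprod x.
  have QE : 'X * (n%:R *: Q) = H * ('X + 1) - 1 by rewrite linprod_invx exprSr.
  have HQ : H = Q + 'X * Q^`().
    apply: (scalerI n0); have := congr1 (@deriv F) linprod_invx.
    rewrite derivM derivX mul1r derivZ derivB derivC subr0 deriv_exp derivD.
    rewrite derivX derivC addr0 mul1r -/H -/Q => e.
    by rewrite scaler_nat -e scalerDr scalerAr.
  have QNE := congr1 (fun p : {poly F} => p \Po - 'X) QE.
  have HNQ := congr1 (fun p : {poly F} => p \Po - 'X) HQ.
  rewrite /= comp_polyD comp_polyM comp_polyX in HNQ.
  rewrite /= comp_polyB !comp_polyM comp_polyD comp_polyX in QNE.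
  rewrite comp_polyZ !comp_polyC in QNE.
  transitivity (H * ((H \Po - 'X) * (- 'X + 1) - 1)
      + (H \Po - 'X) * (H * ('X + 1) - 1)); last by ring.
  rewrite -QNE -QE HNQ HQ -mulrnAr scalerMnr -marked_linprod1_comp.
  rewrite -/Q -!mul_polyC; ring.
have := congr1 (fun p : {poly F} => p`_(2 * k.+1)) HE.
rewrite /= !mulr2n !coefD !coefN !coef_comp_polyNX2 coefXM coefZ /=.
rewrite coef_comp_polyNX !coef_XD1n -!mulr2n.
rewrite exprM sqrrN expr1n expr1n mul1r exprS mulN1r; set s := (-1) ^+ k => e.
have s2 : s * s = 1 by rewrite -expr2 sqrr_sign.
have s0 : s != 0 by rewrite signr_eq0.
have two0 : 2 != 0 :> F by rewrite pnatr_eq0.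
apply: (mulfI n0); apply: (mulfI s0); apply: (mulfI two0).
transitivity (- (- s * (n%:R * T`_k) *+ 2)); first by ring.
rewrite e -[X in _ = 2 * (s * (n%:R * (_ * (_ + s * X))))]mul1r.
transitivity (2 * (s * 'C(n', k.+1)%:R + s * s * 'C(n', 2 * k.+1)%:R)).
  by rewrite s2; ring.
by field.
Qed.

(** * Degenerate Bernoulli numbers and power sums *)

(** Root-of-unity filter: the powers of [q ^+ j] form a geometric sum that vanishes for
    [0 < j < n]. *)
Lemma sum_horner_prim (p : {poly F}) : (size p <= n)%N ->
  \sum_(i < n) p.[q ^+ i] = n%:R * p`_0.
Proof.
move=> sp; under eq_bigr do rewrite (horner_coef_wide _ sp).
rewrite exchange_big big_ord_recl /= [X in _ + X]big1 ?addr0.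
  under eq_bigr do rewrite expr0 mulr1.
  by rewrite sumr_const card_ord mulr_natl.
move=> j _; rewrite -mulr_sumr.
under eq_bigr do rewrite exprAC.
apply/eqP; rewrite mulf_eq0; apply/orP; right.
have j0 : 1 - q ^+ j.+1 != 0.
  by rewrite sub1_prim_expr_neq0 //= ltnS ltn_ord.
rewrite -(mulrI_eq0 _ (lregP j0)) -opprB mulNr -subrX1.
by rewrite exprAC (prim_expr_order qP) expr1n subrr oppr0.
Qed.

(** At [1/n] the binomial series terminates: it is [(1 + t/n)^n]. *)
Lemma degen_expV k : degen_exp n%:R^-1 k = 'C(n, k)%:R / n%:R ^+ k :> F.
Proof.
rewrite /degen_exp invrK exprVn; congr (_ / _).
have -> : \prod_(i < k) (n%:R - i%:R) = (n ^_ k)%:R :> F.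
  elim: k => [|k IH]; first by rewrite big_ord0.
  rewrite big_ord_recr /= IH ffactnSr natrM.
  case: (leqP k n) => kn; first by rewrite natrB.
  by rewrite ffact_small // !mul0r.
by rewrite -bin_ffact natrM mulfK // pnatr_eq0 -lt0n fact_gt0.
Qed.

(* The coefficients of [1 / linprod x], by partial fractions: the residue of
   [n t / ((1 + t) ^ n - 1)] at [t = q ^ i - 1] is [(q ^ i - 1) q ^ i].  The
   case [j = 0] is apart because the sum then counts the junk index [i = 0]. *)
Definition bern_coef (j : nat) : F :=
  if j == 0%N then 1 else - \sum_(i < n) q ^+ i * (- x i) ^+ j.

(** This is the convolution form of [((1 + z)^n - 1) / z] times the series of [bern_coef] being [n].
    For positive degree, [(1 + z)^n = 1] at [z = q ^+ i - 1] trades the low-order part of the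
    expansion for its tail [D], and the sum of the tails is evaluated by the filter. *)
Lemma sum_bin_bern_coef k :
  \sum_(i < k.+1) 'C(n, i.+1)%:R * bern_coef (k - i) = (k == 0%N)%:R * n%:R.
Proof.
rewrite big_ord_recr /= subnn {2}/bern_coef eqxx mulr1.
case: k => [|k]; first by rewrite big_ord0 add0r bin1 mul1r.
rewrite mul0r; pose D := drop_poly k.+2 (('X + 1) ^+ n : {poly F}).
have DE (i : 'I_n) : i != ord0 ->
    \sum_(j < k.+1) 'C(n, j.+1)%:R * (- x i) ^+ (k.+1 - j) = - D.[q ^+ i - 1].
  move=> i0; set r := q ^+ i - 1.
  have r0 : r != 0.
    by rewrite -oppr_eq0 opprB sub1_prim_expr_neq0 // lt0n i0 ltn_ord.
  have xE : - x i = r^-1 by rewrite /invx -invrN opprB.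
  apply: (mulIf (expf_neq0 k.+2 r0)).
  have := congr1 (fun p : {poly F} => p.[r])
    (poly_take_drop k.+2 (('X + 1) ^+ n)).
  rewrite hornerD hornerM hornerXn -/D horner_exp hornerD hornerX hornerC subrK.
  rewrite exprAC (prim_expr_order qP) expr1n => e.
  rewrite mulNr; apply/eqP; rewrite -addr_eq0; apply/eqP.
  apply: (addrI 1); rewrite addr0 -[RHS]e addrA.
  congr (_ + _); rewrite [RHS](horner_coef_wide _ (size_take_poly _ _)).
  rewrite [RHS]big_ord_recl /= coef_take_poly /= coef_XD1n bin0 mul1r.
  congr (_ + _).
  rewrite mulr_suml; apply: eq_bigr => j _ /=.
  rewrite coef_take_poly coef_XD1n /bump /= add1n ltnS ltn_ord -mulrA.
  congr (_ * _).
  rewrite xE exprVn; apply: (mulfI (expf_neq0 (k.+1 - j) r0)).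
  rewrite mulrA mulfV ?expf_neq0 // mul1r -exprD; congr (_ ^+ _).
  by rewrite addnS subnK // ltnW.
transitivity ('C(n, k.+2)%:R - \sum_(i < n) q ^+ i *
   \sum_(j < k.+1) 'C(n, j.+1)%:R * (- x i) ^+ (k.+1 - j)).
  rewrite addrC; congr (_ + _).
  under [in RHS]eq_bigr do rewrite mulr_sumr.
  rewrite exchange_big -sumrN; apply: eq_bigr => j _.
  rewrite /bern_coef subn_eq0 leqNgt ltn_ord /= mulrN mulr_sumr.
  by congr (- _); apply: eq_bigr => i _; rewrite mulrCA.
(* The index 0 contributes nothing: [x ord0 = 0] and all exponents are positive. *)
rewrite big_ord_recl [X in _ * X]big1 ?mulr0 ?add0r; last first.
  move=> j _; rewrite /invx subrr invr0 oppr0 expr0n subn_eq0 leqNgt.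
  by rewrite ltn_ord mulr0.
have size_D : (size ('X * (D \Po ('X - 1%:P)))%R <= n)%N.
  rewrite mulrC; apply: leq_trans (size_polyMleq _ _) _.
  rewrite size_polyX addn2 /= size_comp_poly2 ?size_XsubC //.
  rewrite size_drop_poly.
  apply: leq_ltn_trans (leq_sub2r _ (size_poly_exp_leq _ _)) _.
  by rewrite size_XaddC mul1n; lia.
have := sum_horner_prim _ size_D.
(* The filtered polynomial has the factor ['X], so its sum is 0; the term at [q ^+ 0 = 1] is
   [D.[0]], that is ['C(n, k.+2)]. *)
rewrite coefXM mulr0 big_ord_recl /= expr0.
have E i : ('X * (D \Po ('X - 1%:P))).[i] = i * D.[i - 1].
  by rewrite hornerM hornerX horner_comp hornerD hornerX hornerN hornerC.
rewrite E mul1r subrr horner_coef0 coef_drop_poly coef_XD1n add0n => sum0.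
rewrite -[RHS]sum0.
congr (_ + _); rewrite -sumrN; apply: eq_bigr => i _.
by rewrite E DE // mulrN opprK.
Qed.

(** By the uniqueness in [degen_bernoulliP]: the substitution [t = n * z] turns the defining
    identity at [1/n] into [sum_bin_bern_coef]. *)
Lemma degen_bernoulliV j :
  n%:R ^+ j * degen_bernoulli (n%:R^-1 : F) j / j`!%:R = bern_coef j.
Proof.
have n0 : n%:R != 0 :> F by rewrite pnatr_eq0.
have f0 i : i`!%:R != 0 :> F by rewrite pnatr_eq0 -lt0n fact_gt0.
pose b i := i`!%:R * (bern_coef i / n%:R ^+ i).
suff /degen_bernoulliP <- : forall k,
    series_mul (fun j => degen_exp n%:R^-1 j - (j == 0%N)%:R)
      (fun j => b j / j`!%:R) k = (k == 1%N)%:R.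
- by rewrite /b; field; rewrite f0 expf_neq0.
- by rewrite invr_eq0.
case=> [|k]; rewrite /series_mul.
  by rewrite big_ord1 /= degen_expV bin0 divr1 subrr mul0r.
rewrite big_ord_recl /= degen_expV bin0 divr1 subrr mul0r add0r.
apply: (mulfI (expf_neq0 k.+1 n0)).
transitivity ((k == 0%N)%:R * n%:R : F); last first.
  by case: k => [|k]; rewrite /= ?mul0r ?mulr0 // expr1 mulrC.
rewrite -sum_bin_bern_coef mulr_sumr; apply: eq_bigr => i _.
rewrite /bump /= add1n subr0 subSS degen_expV /b.
have -> : n%:R ^+ k.+1 = n%:R ^+ i.+1 * n%:R ^+ (k - i) :> F.
  by rewrite -exprD addSn subnKC // -ltnS ltn_ord.
by field; rewrite f0 !expf_neq0.
Qed.

Lemma sum_invx_expr s :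
  \sum_i x i ^+ s.+1 = - \sum_(j < s.+1) bern_coef j.+1 * 'C(s, j)%:R.
Proof.
(* For [i > 0], [u i] is both the [x] of index [n - i] and [1 - x i], so reversing the indices
   replaces [x] by [u]. *)
pose u (i : 'I_n) := - (q ^+ i * x i).
transitivity (\sum_i u i ^+ s.+1).
  have x0 : x ord0 = 0 by rewrite /invx subrr invr0.
  rewrite big_ord_recl [RHS]big_ord_recl /u x0 mulr0 oppr0; congr (_ + _).
  rewrite (reindex_inj rev_ord_inj); apply: eq_bigr => i _; congr (_ ^+ _).
  rewrite /invx /= /bump /= !add1n.
  have qq : q ^+ (n' - i.+1).+1 * q ^+ i.+1 = 1.
    by rewrite -exprD addSn subnK // -(prim_expr_order qP).
  have a0 : 1 - q ^+ (n' - i.+1).+1 != 0.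
    by rewrite sub1_prim_expr_neq0 //= ltnS subnSK // leq_subr.
  have b0 : 1 - q ^+ i.+1 != 0 by rewrite sub1_prim_expr_neq0 //= ltnS ltn_ord.
  apply: (mulfI a0); rewrite mulfV //; apply: (mulIf b0).
  by rewrite mul1r mulrN mulrA mulNr mulfVK // mulrBl mul1r qq opprB.
rewrite -sumrN.
under [RHS]eq_bigr do rewrite /bern_coef /= mulNr opprK mulr_suml.
rewrite exchange_big; apply: eq_bigr => i _.
(* One factor [u i] is kept: it vanishes at the index 0, where [1 - x i] is 1. *)
transitivity (u i * (1 - x i) ^+ s); last first.
  rewrite exprDn mulr_sumr; apply: eq_bigr => j _.
  by rewrite expr1n mul1r /u exprS -mulr_natr; ring.
rewrite exprS /u; case: (eqVneq (i : nat) 0%N) => [i0|i0].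
  by rewrite /invx i0 subrr invr0 mulr0 oppr0 !mul0r.
congr (_ * _ ^+ _); rewrite /invx; field.
by rewrite sub1_prim_expr_neq0 // lt0n i0 ltn_ord.
Qed.

End PrimitiveRoot.

(** * Unrolling the recursion in the exponent *)

(** Each use of [marked_linprodSS] lowers the exponent by 2, raises the degree by 1 and flips the
    sign. *)
Lemma coef_marked_linprod_unroll {F : comNzRingType} {I : finType} (x : I -> F)
    (B K m : nat) :
  (marked_linprod x (B + 2 * K))`_m =
  \sum_(k < K) (-1) ^+ k * (\sum_i x i ^+ (B + 2 * (K - k.+1))) *
      (linprod (fun i => x i ^+ 2))`_(m + k).+1
  + (-1) ^+ K * (marked_linprod x B)`_(m + K).
Proof.
elim: K m => [|K IH] m; first by rewrite big_ord0 muln0 !addn0 add0r mul1r.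
have := congr1 (fun p : {poly F} => p`_m.+1) (marked_linprodSS x (B + 2 * K)).
rewrite coefXM /= coefB coefZ mulnS addnCA => ->.
rewrite IH big_ord_recl subSS subn0 mul1r addn0 opprD addrA addSnnS.
rewrite exprS mulN1r mulNr; congr (_ + _ - _).
rewrite -sumrN; apply: eq_bigr => k _.
by rewrite lift0 exprS mulN1r !mulNr subSS addSnnS.
Qed.

(** * Primitivity of [zeta R n] *)

Lemma zeta_expr (R : realType) (n k : nat) :
  zeta R n ^+ k =
  Complex (cos (2 * pi / n%:R * k%:R)) (sin (2 * pi / n%:R * k%:R)).
Proof.
elim: k => [|k IH]; first by rewrite expr0 mulr0 cos0 sin0.
rewrite exprSr IH /zeta; set t : R := 2 * pi / n%:R.
have -> : t * k.+1%:R = t * k%:R + t by ring.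
rewrite cosD sinD.
by apply/eqP; rewrite eq_complex /= [X in _ && (_ == X)]addrC !eqxx.
Qed.

Lemma zeta_prim_root (R : realType) (n : nat) : (0 < n)%N ->
  n.-primitive_root (zeta R n).
Proof.
move=> n0; have n0R : 0 < n%:R :> R by rewrite ltr0n.
apply/andP; split=> //; apply/forallP => i; rewrite unity_rootE; apply/eqP.
case: (eqVneq i.+1 n) => [->|i_n].
  apply/eqP; rewrite zeta_expr divfK ?lt0r_neq0 //.
  have -> : 2 * pi = pi *+ 2 :> R by ring.
  rewrite cos2pi.
  by have -> : sin (pi *+ 2) = 0 :> R by rewrite sin_mulr2n sinpi mulr0 mul0rn.
apply/negbTE/eqP => /(congr1 (@complex.Re R)); rewrite zeta_expr /=.
(* Half the angle of the power: [t] lies strictly between 0 and [pi] when [i.+1 < n], while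
   [cos (t *+ 2) = 1] would force [sin t = 0]. *)
pose t : R := pi / n%:R * i.+1%:R.
have -> : 2 * pi / n%:R * i.+1%:R = t *+ 2 by rewrite /t; ring.
rewrite cos_mulr2n cos2sin2 => cos1.
have : 0 < sin t.
  apply: sin_gt0_pi; rewrite /t mulr_gt0 ?divr_gt0 ?pi_gt0 ?ltr0n //=.
  rewrite mulrAC ltr_pdivrMr // ltr_pM2l ?pi_gt0 // ltr_nat.
  by rewrite ltn_neqAle i_n ltn_ord.
have : sin t ^+ 2 = 0.
  transitivity ((1 - ((1 - sin t ^+ 2) *+ 2 - 1)) / 2); first by field.
  by rewrite cos1 subrr mul0r.
by move/eqP; rewrite sqrf_eq0 => /eqP ->; rewrite ltxx.
Qed.

(** * Assembly of the two parities *)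

(** Common to both parities, with [B = 2] for even and [B = 1] for odd exponents; [n] and [m] are
    one less than in the theorem. *)
Lemma sum_frakZ_unroll (F : numFieldType) (n m B K : nat) (q : F) :
  n.+1.-primitive_root q -> (0 < B)%N ->
  \sum_(j < m.+1) frakZ n.+1 q (two_but_at j (B + 2 * K)) =
  \sum_(0 <= k < K) \sum_(1 <= j < (B + 2 * K - 2 * k - 2).+1)
      ((-1) ^+ (k + 1) * n.+1%:R ^+ j * degen_bernoulli (n.+1%:R^-1 : F) j
         / (n.+1%:R * (m.+1 + k + 1)%:R * j`!%:R)
       * 'C(B + 2 * K - 2 * k - 3, j - 1)%:R
       * ('C(n, m.+1 + k)%:R
          + (-1) ^+ (m.+1 + k) * 'C(n, 2 * m.+1 + 2 * k + 1)%:R))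
  + (-1) ^+ K * (marked_linprod (invx q : 'I_n.+1 -> F) B)`_(m + K).
Proof.
move=> qP B0; rewrite sum_frakZ ?addn_gt0 ?B0 // coef_marked_linprod_unroll.
congr (_ + _); rewrite big_mkord; apply: eq_bigr => k _.
have := ltn_ord k; set k' := nat_of_ord k; move: k' => {}k kK.
have -> : (B + 2 * (K - k.+1) = (B + 2 * K - 2 * k - 3).+1)%N by lia.
have -> : ((B + 2 * K - 2 * k - 2) = (B + 2 * K - 2 * k - 3).+1)%N by lia.
set s := (B + 2 * K - 2 * k - 3)%N.
rewrite (sum_invx_expr _ _ _ qP) (coef_linprod_sqr_invx _ _ _ qP).
rewrite mulrN mulr_sumr mulNr mulr_suml -sumrN big_add1 /= big_mkord.
apply: eq_bigr => j _; rewrite -(degen_bernoulliV _ _ _ qP) subn1 /=.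
have -> : ((2 * (m + k).+1).+1 = 2 * m.+1 + 2 * k + 1)%N by lia.
rewrite [(k + 1)%N]addn1 [(-1) ^+ k.+1]exprS mulN1r addSn.
rewrite [((m + k).+1 + 1)%N]addn1 !invfM; ring.
Qed.

Theorem theorem4 (R : realType) (n m : nat) (hn : (0 < n)%N) (hm : (0 < m)%N) :
  (forall A : nat, (2 <= A)%N -> ~~ odd A ->
    \sum_(j < m) frakZ n (zeta R n) (two_but_at j A) =
    \sum_(0 <= k < A %/ 2 - 1) \sum_(1 <= j < (A - 2 * k - 2).+1)
      ((-1) ^+ (k + 1) * n%:R ^+ j * degen_bernoulli (n%:R^-1 : R[i]) j
         / (n%:R * (m + k + 1)%:R * j`!%:R)
       * 'C(A - 2 * k - 3, j - 1)%:R
       * ('C(n - 1, m + k)%:R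
          + (-1) ^+ (m + k) * 'C(n - 1, 2 * m + 2 * k + 1)%:R))
    + (-1) ^+ (A %/ 2 - 1)
      * ((m + A %/ 2 - 1)%:R / (n%:R * (m + A %/ 2)%:R))
      * ('C(n - 1, m + A %/ 2 - 1)%:R
         + (-1) ^+ (m + A %/ 2 - 1) * 'C(n - 1, 2 * m + A - 1)%:R))
  /\
  (forall A : nat, (1 <= A)%N -> odd A ->
    \sum_(j < m) frakZ n (zeta R n) (two_but_at j A) =
    \sum_(0 <= k < (A - 1) %/ 2) \sum_(1 <= j < (A - 2 * k - 2).+1)
      ((-1) ^+ (k + 1) * n%:R ^+ j * degen_bernoulli (n%:R^-1 : R[i]) j
         / (n%:R * (m + k + 1)%:R * j`!%:R)
       * 'C(A - 2 * k - 3, j - 1)%:R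
       * ('C(n - 1, m + k)%:R
          + (-1) ^+ (m + k) * 'C(n - 1, 2 * m + 2 * k + 1)%:R))
    + (-1) ^+ ((A - 1) %/ 2)
      * (1 / n%:R)
      * ('C(n - 1, m + (A - 1) %/ 2)%:R
         (* m + (A - 1) / 2 - 1 is m + (A - 3) / 2, nonnegative also for A = 1 *)
         + (-1) ^+ (m + (A - 1) %/ 2 - 1) * 'C(n - 1, 2 * m + A - 1)%:R)).
Proof.
have qP := zeta_prim_root R n hn; move: (zeta R n) qP => q.
case: n hn => // n _; case: m hm => // m _ qP; rewrite [(n.+1 - 1)%N]subn1.
split=> A A_ge parA.
- pose K := (A %/ 2 - 1)%N; have AE : A = (2 + 2 * K)%N by lia.
  have -> : (A %/ 2 = K.+1)%N by lia.
  have -> : (2 * m.+1 + A - 1 = (2 * (m + K).+1).+1)%N by lia.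
  rewrite {}AE sum_frakZ_unroll // !subn1 /=; congr (_ + _).
  (* The base case [B = 2] is a derivative; differentiation supplies the factor [(m + K).+1], the
     numerator in the last term. *)
  rewrite -deriv_linprod_sqr coef_deriv (coef_linprod_sqr_invx _ _ _ qP).
  by rewrite !addSn !addnS /=; ring.
- pose K := ((A - 1) %/ 2)%N; have AE : A = (1 + 2 * K)%N by lia.
  rewrite -/K; have -> : (2 * m.+1 + A - 1 = 2 * (m + K).+1)%N by lia.
  rewrite {}AE sum_frakZ_unroll //; congr (_ + _).
  rewrite (coef_marked_linprod1_invx _ _ _ qP) !addSn subn1 /=.
  by rewrite mul1r !mulrA.
Qed.
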